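(* Let $E, F, G$ be real Banach spaces, let $U_E \subset E$ and $U_F \subset F$ be open, and let $k \in \mathbb{N}_0$. Let $\phi \in C^k(U_E, F)$ and $\psi \in C^k(U_F, G)$, and let $x \in U_E$ be a point with $y := \phi(x) \in U_F$. Then $\psi\circ\phi$ is of class $C^k$ on its domain of definition, the open set $\phi^{-1}(U_F) \subset U_E$ (so $\psi \circ \phi \in C^k(U_E, G)$ when $\phi(U_E) \subset U_F$), and the reduced Taylor polynomials compose: $$T_{\ast}^k(\psi\circ\phi;\, x) = \pi_{\le k}\bigl(T_{\ast}^k(\psi;\, y) \circ T_{\ast}^k(\phi;\, x)\bigr).$$
   Context: For Banach spaces $E,F$, $\mathcal{L}^s(^k E, F)$ denotes the Banach space of bounded symmetric $k$-multilinear maps $E^{\times k} \to F$ (equal to $F$ for $k=0$). Differentiability is in the Fréchet sense: $C^0$ means continuous; $\phi: U_E \to F$ is $C^1$ if it is Fréchet differentiable at every point and its derivative is continuous as a map into the bounded linear maps with operator norm; recursively, $\phi$ is $C^k$ if it is $C^1$ and its derivative is $C^{k-1}$. $C^k(U_E,F)$ is the space of such maps, and $D^\ell(\phi;x) \in \mathcal{L}^s(^\ell E,F)$ denotes the $\ell$-th Fréchet derivative at $x$, with value $D^\ell(\phi;x;v_1,\dots,v_\ell)$ on $v_1,\dots,v_\ell\in E$. A $j$-homogeneous polynomial $E \to F$ is a map of the form $v \mapsto \frac{1}{j!} A[v,\dots,v]$ with $A \in \mathcal{L}^s(^j E, F)$; a polynomial map is a finite sum of homogeneous polynomials $p=\sum_j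 p_j$, and the homogeneous components $p_j$ are uniquely determined by $p$. Compositions of polynomial maps are polynomial maps. The degree truncation is $\pi_{\le k}(p) := \sum_{j \le k} p_j$. The reduced Taylor polynomial of $\phi \in C^k(U_E,F)$ at $x \in U_E$ is the polynomial map $T_{\ast}^k(\phi;x): E \to F$ given by $$T_{\ast}^k(\phi;x;v) = \sum_{\ell=1}^k \frac{1}{\ell!} D^\ell(\phi;x;v,\dots,v).$$ It is the Taylor polynomial of order $k$ with its constant term $\phi(x)$ removed. *)

(* Defs.v *)
From HB Require Import structures.
From mathcomp Require Import all_boot all_order all_algebra all_fingroup.
From mathcomp Require Import all_classical all_reals all_analysis.

Set Implicit Arguments.
Unset Strict Implicit.
Unset Printing Implicit Defensive.

Import Order.TTheory GRing.Theory Num.Theory.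
Import numFieldNormedType.Exports.

Local Open Scope classical_set_scope.
Local Open Scope ring_scope.

Section BoundedLinear.
Context {R : realType} (E F : normedModType R).

Definition bounded_linear (f : E -> F) : Prop :=
  linear f /\ exists M : R, forall v, `|f v| <= M * `|v|.

Definition blin_pred : {pred E -> F} := mem [set f | bounded_linear f].

Lemma blin_submod_closed : submod_closed blin_pred.
Proof.
split; first by rewrite inE; split=> [a u v|]; [rewrite scaler0 addr0|
  exists 0 => v; rewrite normr0 mul0r].
move=> a f g; rewrite !inE => -[lf [Mf bf]] [lg [Mg bg]]; split.
  move=> b u v; rewrite !fctE /= lf lg !scalerDr !scalerA (mulrC b a).
  by rewrite addrACA.
exists (`|a| * Mf + Mg) => v; rewrite !fctE /=.
rewrite (le_trans (ler_normD _ _))// mulrDl lerD// normrZ -mulrA.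
by rewrite ler_wpM2l.
Qed.

HB.instance Definition _ :=
  GRing.isSubmodClosed.Build R (E -> F) blin_pred blin_submod_closed.

Record blin : Type := Blin { blin_fun :> E -> F; _ : blin_fun \in blin_pred }.

HB.instance Definition _ := [isSub of blin for blin_fun].
HB.instance Definition _ := [Choice of blin by <:].
HB.instance Definition _ := [SubChoice_isSubLmodule of blin by <:].

Lemma blinP (f : blin) : bounded_linear f.
Proof. by have := valP f; rewrite inE. Qed.

Definition opnorm (f : blin) : R := sup [set `|f v| | v in [set v | `|v| <= 1]].

Let has_sup_opnorm (f : blin) : has_sup [set `|f v| | v in [set v | `|v| <= 1]].
Proof.
have [_ [M bf]] := blinP f; split; first by exists `|f 0|, 0; rewrite /= ?normr0.
exists `|M| => _ [v /= v1 <-]; rewrite (le_trans (bf v))//.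
by rewrite (le_trans (ler_wpM2r _ (ler_norm M)))// ler_piMr.
Qed.

Let opnorm_ub (f : blin) v : `|v| <= 1 -> `|f v| <= opnorm f.
Proof. by move=> v1; apply: (ub_le_sup (has_sup_opnorm f).2); exists v. Qed.

Let opnorm_le (f : blin) M : (forall v, `|v| <= 1 -> `|f v| <= M) -> opnorm f <= M.
Proof.
move=> H; apply: ge_sup; first exact: (has_sup_opnorm f).1.
by move=> _ [v v1 <-]; exact: H.
Qed.

Let opnormD (f g : blin) : opnorm (f + g) <= opnorm f + opnorm g.
Proof.
by apply: opnorm_le => v v1; rewrite (le_trans (ler_normD _ _))// lerD// opnorm_ub.
Qed.

Let opnormZ (a : R) (f : blin) : opnorm (a *: f) = `|a| * opnorm f.
Proof.
have le b (g : blin) : opnorm (b *: g) <= `|b| * opnorm g.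
  by apply: opnorm_le => v v1; rewrite [leLHS]normrZ ler_wpM2l// opnorm_ub.
apply/eqP; rewrite eq_le le /=; have [->|a0] := eqVneq a 0.
  rewrite normr0 mul0r; apply: le_trans (opnorm_ub _ (v := 0) _) => //.
  by rewrite normr0.
rewrite mulrC -ler_pdivlMr ?normr_gt0// mulrC -normfV.
by rewrite -[in leLHS](scalerK a0 f) le.
Qed.

Let opnorm0_eq0 (f : blin) : opnorm f = 0 -> f = 0.
Proof.
move=> f0; apply/val_inj/funext => v /=.
have [lf _] := blinP f.
have f00 : f 0 = 0 by have := lf (-1) 0 0; rewrite scaler0 addr0 scaleN1r addNr.
have [->|v0] := eqVneq v 0; first exact: f00.
have := @opnorm_ub f (`|v|^-1 *: v).
have -> : f (`|v|^-1 *: v) = `|v|^-1 *: f v.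
  by have := lf `|v|^-1 v 0; rewrite f00 !addr0.
rewrite f0 !normrZ normfV normr_id mulVf ?normr_eq0// => /(_ (lexx _)).
by rewrite pmulr_rle0 ?invr_gt0 ?normr_gt0// normr_le0 => /eqP.
Qed.

HB.instance Definition _ := Lmodule_isNormed.Build R blin
  opnormD opnormZ opnorm0_eq0.

Lemma blin_normE (f : blin) : `|f| = opnorm f.
Proof. by []. Qed.

End BoundedLinear.

(* Maps defined on an open set U are represented by total functions whose
   values outside U are irrelevant: every notion below is used only at points
   of U and depends only on the germ of the map there. *)
Section Differentiability.
Context {R : realType} {E : normedModType R}.

(* insubd only supplies a dummy value where phi is not differentiable: see
   fderivE. *)
Definition fderiv (F : normedModType R) (phi : E -> F) (x : E) : blin E F :=
  insubd 0 ('d phi x : E -> F).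

Lemma fderivE (F : normedModType R) (phi : E -> F) (x : E) :
  differentiable phi x -> fderiv phi x = 'd phi x :> (E -> F).
Proof.
move=> dphi; rewrite /fderiv val_insubd; case: ifPn => //; rewrite notin_setE.
case; split; first exact: linearP.
have /linear_boundedP : bounded_near ('d phi x) (nbhs 0).
  by apply/linear_bounded_continuous/diff_continuous.
by case=> M [_ /(_ (M + 1))]; rewrite ltrDl ltr01 => /(_ isT) H; exists (M + 1).
Qed.

Definition class_C0 (F : normedModType R) (U : set E) (phi : E -> F) : Prop :=
  forall x, U x -> {for x, continuous phi}.

Definition class_C1 (F : normedModType R) (U : set E) (phi : E -> F) : Prop :=
  (forall x, U x -> differentiable phi x) /\ class_C0 U (fderiv phi).

Fixpoint class_C (k : nat) (F : normedModType R) (U : set E) (phi : E -> F)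
    : Prop :=
  match k with
  | 0 => class_C0 U phi
  | k'.+1 => class_C1 U phi /\ class_C k' U (fderiv phi)
  end.

(* The innermost derivative consumes the last vector, so that
   dern 2 phi x v = D(D phi)(x)[v_0][v_1]. *)
Fixpoint dern (l : nat) (F : normedModType R) (phi : E -> F) (x : E)
    : ('I_l -> E) -> F :=
  match l with
  | 0 => fun=> phi x
  | l'.+1 => fun v =>
      dern (fderiv phi) x (fun i : 'I_l' => v (widen_ord (leqnSn l') i))
        (v ord_max)
  end.

Definition taylor_red (F : normedModType R) (k : nat) (phi : E -> F) (x : E)
    : E -> F :=
  fun v => \sum_(1 <= l < k.+1) (l`!%:R)^-1 *: dern phi x (fun _ : 'I_l => v).

End Differentiability.

Section Polynomials.
Context {R : realType} {E F : normedModType R}.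

(* Membership in L^s(^j E, F). *)
Definition bounded_sym_multilinear (j : nat) (A : ('I_j -> E) -> F) : Prop :=
  [/\ forall (v : 'I_j -> E) (i : 'I_j), linear (fun u : E => A (dfwith v i u)),
      forall (s : 'S_j) (v : 'I_j -> E), A (v \o s) = A v
    & exists M : R, forall v : 'I_j -> E, `|A v| <= M * \prod_(i < j) `|v i| ].

Definition homogeneous_poly (j : nat) (p : E -> F) : Prop :=
  exists2 A : ('I_j -> E) -> F, bounded_sym_multilinear A &
    p = fun v => (j`!%:R)^-1 *: A (fun=> v).

Definition homogeneous_decomp (p : E -> F) (c : nat -> E -> F) : Prop :=
  (forall j, homogeneous_poly j (c j)) /\
  exists n : nat, (forall j, (n <= j)%N -> c j = 0) /\
    p = fun v => \sum_(j < n) c j v.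

Definition polynomial_map (p : E -> F) : Prop :=
  exists c, homogeneous_decomp p c.

Lemma homogeneous_polyZ j (p : E -> F) t v :
  homogeneous_poly j p -> p (t *: v) = t ^+ j *: p v.
Proof.
move=> [A [linA _ _] ->]; rewrite scalerA mulrC -scalerA; congr (_ *: _).
have linA0 (w : 'I_j -> E) i : A (dfwith w i (0 : E)) = 0.
  have := linA w i (-1) 0 0; rewrite scaler0 addr0 scaleN1r.
  by move=> H; rewrite [LHS]H addNr.
have step (m : nat) : (m <= j)%N ->
    A (fun i => if (i < m)%N then t *: v else v) = t ^+ m *: A (fun=> v).
  elim: m => [_|m IH mj]; first by rewrite expr0 scale1r.
  pose w (i : 'I_j) := if (i < m)%N then t *: v else v.
  pose i0 := Ordinal mj.
  have Ew u : dfwith w i0 u = fun i : 'I_j => if i == i0 then u else w i.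
    apply/funext => i; case: dfwithP => [|k]; first by rewrite eqxx.
    by rewrite eq_sym => /negbTE ->.
  have -> : (fun i : 'I_j => if (i < m.+1)%N then t *: v else v) =
            dfwith w i0 (t *: v).
    rewrite Ew; apply/funext => i; rewrite /w ltnS leq_eqVlt -val_eqE /=.
    by case: eqP.
  have := linA w i0 t v 0; rewrite linA0 !addr0 => ->.
  have -> : dfwith w i0 v = w.
    rewrite Ew; apply/funext => i; rewrite /w -val_eqE /=.
    by case: eqP => // ->; rewrite ltnn.
  by rewrite IH ?(ltnW mj)// scalerA exprS.
rewrite -step //; congr (A _); apply/funext => i.
by rewrite ltn_ord.
Qed.

Lemma vector_poly_eq0 n (a : nat -> F) :
  (forall t : R, \sum_(j < n) t ^+ j *: a j = 0) ->
  forall j, (j < n)%N -> a j = 0.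
Proof.
elim: n a => [//|n IH] a Ha.
have Hlow j : (j < n)%N -> a j = 0.
  move=> jn; have : (2 ^+ n - 2 ^+ j : R) *: a j = 0.
    apply: (IH (fun j => (2 ^+ n - 2 ^+ j : R) *: a j)) => // t.
    have H1 := Ha t; have H2 := Ha (2 * t).
    rewrite !big_ord_recr /= in H1 H2.
    have : (2 : R) ^+ n *: (\sum_(i < n) t ^+ i *: a i + t ^+ n *: a n) -
       (\sum_(i < n) (2 * t) ^+ i *: a i + (2 * t) ^+ n *: a n) = 0.
      by rewrite H1 H2 scaler0 subr0.
    rewrite scalerDr scaler_sumr scalerA -exprMn opprD addrACA subrr addr0.
    rewrite -sumrB => E0; rewrite -[RHS]E0; apply: eq_bigr => i _.
    by rewrite !scalerA -scalerBl mulrBr exprMn ![t ^+ i * _]mulrC.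
  move/eqP; rewrite scaler_eq0 subr_eq0 => /orP[|/eqP//].
  by rewrite gt_eqF // ltr_eXn2l ?ltr1n.
move=> j; rewrite ltnS leq_eqVlt => /orP[/eqP ->|]; last exact: Hlow.
have := Ha 1; rewrite big_ord_recr /= big1 ?add0r ?expr1n ?scale1r//.
by move=> i _; rewrite Hlow ?scaler0.
Qed.

Lemma homogeneous_decomp_uniq (p : E -> F) c d :
  homogeneous_decomp p c -> homogeneous_decomp p d -> c = d.
Proof.
move=> [hc [n [c0 pc]]] [hd [m [d0 pd]]].
apply/funext => j; apply/funext => v; apply/eqP; rewrite -subr_eq0; apply/eqP.
have ext (e : nat -> E -> F) k u : (forall j, (k <= j)%N -> e j = 0) ->
    (k <= n + m + j.+1)%N ->
    \sum_(i < n + m + j.+1) e i u = \sum_(i < k) e i u.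
  move=> e0 kN; rewrite [RHS](big_ord_widen _ (fun i => e i u) kN).
  rewrite [RHS]big_mkcond; apply: eq_bigr => i _; case: ltnP => // /e0 ->.
  by [].
apply: (@vector_poly_eq0 (n + m + j.+1) (fun j => c j v - d j v)); last first.
  by rewrite addnS ltnS leq_addl.
move=> t; under eq_bigr do
  rewrite scalerBr -(homogeneous_polyZ _ _ (hc _)) -(homogeneous_polyZ _ _ (hd _)).
rewrite sumrB (ext c n)// ?(ext d m)//.
- have := congr1 (fun f => f (t *: v)) pc; rewrite pd /= => ->; exact: subrr.
- by rewrite addnAC leq_addl.
- by rewrite -addnA leq_addr.
Qed.

(* The value 0 is a dummy for maps that are not polynomial; see hcompE. *)
Definition hcomp (p : E -> F) : nat -> E -> F :=
  xget (fun _ _ => 0) [set c | homogeneous_decomp p c].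

Lemma hcompE (p : E -> F) c : homogeneous_decomp p c -> hcomp p = c.
Proof.
move=> pc; apply: (homogeneous_decomp_uniq _ pc).
exact: (@xgetPex _ (fun=> (fun=> 0)) [set d | homogeneous_decomp p d]
  (ex_intro _ c pc)).
Qed.

Definition trunc_deg (k : nat) (p : E -> F) : E -> F :=
  fun v => \sum_(j < k.+1) hcomp p j v.

End Polynomials.

(* Main.v *)
Require Import Defs.
From HB Require Import structures.
From mathcomp Require Import all_boot all_order all_algebra all_fingroup.
From mathcomp Require Import all_classical all_reals all_analysis.
From mathcomp Require Import lra.

Set Implicit Arguments.
Unset Strict Implicit.
Unset Printing Implicit Defensive.

Import Order.TTheory GRing.Theory Num.Theory.
Import numFieldNormedType.Exports.

Local Open Scope classical_set_scope.
Local Open Scope ring_scope.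

(** The chain rule gives the smoothness claim.  On the domain of psi \o phi one
has D (psi \o phi) x = (D psi (phi x)) \o (D phi x), a bounded bilinear
expression in (D psi) \o phi and D phi, so class C^k.+1 of the composite
reduces to class C^k of a composite and of a bilinear expression
([class_C_comp]).  Differentiating B (f x) (g x) yields two terms of the same
shape, with B replaced by its lifts [bilin_liftl] and [bilin_liftr], hence
[class_C_bilinear] goes by induction on k with B varying.

The Taylor identity compares two expansions of the same function along a ray.
Fix v and put y = phi x.  By Taylor's formula with Peano remainder
([taylor_peano]) for the composite,
  psi (phi (x + t v)) = psi y + T (psi \o phi) (t v) + o(t^k).
By the same formula for psi and for phi, and because polynomials are Lipschitz
near 0,
  psi (phi (x + t v)) = psi y + T psi (T phi (t v)) + o(t^k)
([taylor_comp_line]).  Here T psi \o T phi is a polynomial map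
([curried_poly_comp]), hence the sum of its homogeneous components c_j, and
c_j (t v) = t^j c_j v.  Components of degree above k contribute o(t^k), so the
two expansions give a polynomial in t of degree at most k, with coefficients in
G, that is o(t^k); all its coefficients vanish ([littleo_power_poly_eq0]).
That is the identity at v, one degree at a time.

Homogeneous polynomials are handled in curried form: degree j.+1 means
v |-> c v v with c : E -> blin E F of degree j.  This is the recursion that
[dern] follows on the diagonal, and it lets the same two lifts of a bounded
bilinear map that serve for derivatives show that products and composites are
polynomial.  The symmetric multilinear form asked for by [homogeneous_poly] is
produced in a single place, by averaging over permutations
([curried_homogeneous_poly]). *)

(** * Bounded linear maps and Frechet derivatives *)

Section BlinLinear.
Context {R : realType} {E F : normedModType R}.

Definition blin_linear (f : blin E F) : linear f := (blinP f).1.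

HB.instance Definition _ (f : blin E F) :=
  GRing.isLinear.Build R E F *:%R f (blin_linear f).

End BlinLinear.

Section BoundedLinear.
Context {R : realType} {E F : normedModType R}.
Implicit Types f g : blin E F.

Lemma blinDE f g v : (f + g) v = f v + g v. Proof. by []. Qed.
Lemma blinNE f v : (- f) v = - f v. Proof. by []. Qed.
Lemma blinZE a f v : (a *: f) v = a *: f v. Proof. by []. Qed.

Lemma blinEP f g : (forall v, f v = g v) -> f = g.
Proof. by move=> fg; apply/val_inj/funext. Qed.

Lemma blin_norm_le f M : 0 <= M ->
  (forall v, `|f v| <= M * `|v|) -> `|f| <= M.
Proof.
move=> M0 fM; rewrite blin_normE; apply: ge_sup.
  by exists `|f 0|, 0; rewrite /= ?normr0.
move=> _ [v /= v1 <-]; apply: le_trans (fM v) _.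
by rewrite ler_piMr.
Qed.

Lemma blin_norm_ub f v : `|f v| <= `|f| * `|v|.
Proof.
have [->|v0] := eqVneq v 0; first by rewrite linear0 !normr0 mulr0.
have -> : v = `|v| *: (`|v|^-1 *: v).
  by rewrite scalerA divff ?normr_eq0// scale1r.
set u := `|v|^-1 *: v.
have u1 : `|u| = 1 by rewrite normrZ normfV normr_id mulVf ?normr_eq0.
clearbody u.
rewrite linearZ !normrZ normr_id u1 mulr1 mulrC ler_wpM2r// blin_normE.
apply: ub_le_sup; last by exists u; rewrite //= u1.
have [_ [M bf]] := blinP f; exists `|M| => _ [w /= w1 <-].
by rewrite (le_trans (bf w))// (le_trans (ler_wpM2r _ (ler_norm M)))// ler_piMr.
Qed.

Lemma blin_continuous f : continuous f.
Proof.
apply/linear_bounded_continuous/linear_boundedP.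
near=> r => v; apply: le_trans (blin_norm_ub f v) _.
by rewrite ler_wpM2r//; near: r; apply: nbhs_pinfty_ge; rewrite num_real.
Unshelve. all: by end_near. Qed.

(** Total, so that operator-valued maps can be defined before boundedness of
    their values is proved: the value is 0 when f is not bounded linear, and
    [to_blinE] gives the intended meaning. *)
Definition to_blin (f : E -> F) : blin E F := insubd 0 f.

Lemma to_blinE (f : E -> F) : bounded_linear f -> to_blin f = f :> (E -> F).
Proof.
by move=> bf; rewrite /to_blin val_insubd; case: ifPn => //; rewrite notin_setE.
Qed.

End BoundedLinear.

Section Frechet.
Context {R : realType} {E F : normedModType R}.
Implicit Types (f : E -> F) (L : blin E F).

(** The epsilon form of differentiability: it depends visibly only on the germ
    of f at x, which [near_eq_is_diff] exploits. *)
Lemma is_diffP f (x : E) L : is_diff x f L <->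
  forall e, 0 < e -> \forall h \near 0, `|f (h + x) - (f x + L h)| <= e * `|h|.
Proof.
have -> : (forall e, 0 < e ->
    \forall h \near 0, `|f (h + x) - (f x + L h)| <= e * `|h|) <->
    f \o shift x = cst (f x) + (L : E -> F) +o_ 0 id.
  by split=> [H|/eqaddoP H]; [apply/eqaddoP|]; exact: H.
split=> [[df dfL]|H].
  by rewrite -dfL; exact: diff_locally.
have dL : 'd f x = L :> (E -> F).
  by apply: (diff_unique (@blin_continuous _ _ _ L)).
split=> //; apply/diff_locallyP; rewrite dL; split=> //.
exact: blin_continuous.
Qed.

Lemma is_diff_fderiv f (x : E) : differentiable f x -> is_diff x f (fderiv f x).
Proof. by move=> df; split=> //; rewrite fderivE. Qed.

Lemma fderiv_eq f (x : E) L : is_diff x f L -> fderiv f x = L.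
Proof. by move=> [df dL]; apply: blinEP => v; rewrite fderivE// dL. Qed.

Lemma near_eq_is_diff f g (x : E) L :
  {near x, f =1 g} -> is_diff x f L -> is_diff x g L.
Proof.
move=> fg /is_diffP H; apply/is_diffP => e e0.
have := H e e0; rewrite (nbhs_singleton fg).
move: fg; rewrite (near_shift 0) => fg.
by apply: filterS2 fg => h /=; rewrite subr0 => ->.
Qed.

End Frechet.

(** * Bounded bilinear maps *)

Section Bilinear.
Context {R : realType} {F1 F2 H : normedModType R}.
Implicit Types (B : F1 -> F2 -> H).

Definition bounded_bilinear B : Prop :=
  [/\ forall v, linear (B^~ v), forall u, linear (B u) &
      exists2 M : R, 0 <= M & forall u v, `|B u v| <= M * `|u| * `|v| ].

Section Theory.
Variables (B : F1 -> F2 -> H) (bB : bounded_bilinear B).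

Lemma bounded_bilinearBr u v v' : B u (v - v') = B u v - B u v'.
Proof.
case: bB => _ lB _; have := lB u (-1) v' v.
by rewrite !scaleN1r ![- _ + _]addrC => ->.
Qed.

Lemma bounded_bilinearBl u u' v : B (u - u') v = B u v - B u' v.
Proof.
case: bB => lB _ _; have := lB v (-1) u' u.
by rewrite !scaleN1r ![- _ + _]addrC => ->.
Qed.

Lemma bounded_bilinearDr u v v' : B u (v + v') = B u v + B u v'.
Proof. by case: bB => _ lB _; have := lB u 1 v v'; rewrite !scale1r. Qed.

Lemma bounded_bilinearDl u u' v : B (u + u') v = B u v + B u' v.
Proof. by case: bB => lB _ _; have := lB v 1 u u'; rewrite !scale1r. Qed.

(** B q - B p = B (q.1 - p.1) q.2 + B p.1 (q.2 - p.2), and both terms tend to 0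
    by the norm bound. *)
Lemma bounded_bilinear_continuous : continuous (fun p => B p.1 p.2).
Proof.
case: (bB) => _ _ [M M0 MB] p; apply/subr_cvg0.
apply/norm_cvg0P/(@squeeze_cvgr _ _ _ _ (cst 0)
  (fun q : F1 * F2 => M * `|q.1 - p.1| * `|q.2| + M * `|p.1| * `|q.2 - p.2|)).
- near=> q; rewrite normr_ge0 /=.
  have -> : B q.1 q.2 - B p.1 p.2 = B (q.1 - p.1) q.2 + B p.1 (q.2 - p.2).
    by rewrite bounded_bilinearBr bounded_bilinearBl subrKA.
  by apply: le_trans (ler_normD _ _) _; apply: lerD.
- exact: cvg_cst.
have c1 : (fun q : F1 * F2 => `|q.1 - p.1|) @ p --> (0 : R).
  by apply/norm_cvg0P/subr_cvg0; exact: cvg_fst.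
have c2 : (fun q : F1 * F2 => `|q.2 - p.2|) @ p --> (0 : R).
  by apply/norm_cvg0P/subr_cvg0; exact: cvg_snd.
have -> : (0 : R) = M * 0 * `|p.2| + M * `|p.1| * 0 by rewrite !mulr0 mul0r addr0.
apply: cvgD; apply: cvgM => //; try exact: cvg_cst.
- by apply: cvgM => //; exact: cvg_cst.
- by apply: cvg_norm; exact: cvg_snd.
Unshelve. all: by end_near. Qed.

Lemma is_diff_bilinear (E : normedModType R) (f : E -> F1) (g : E -> F2) x df dg :
  is_diff x f df -> is_diff x g dg ->
  is_diff x (fun y => B (f y) (g y)) (fun v => B (df v) (g x) + B (f x) (dg v)).
Proof.
move=> dfx dgx.
case: (bB) => lBl lBr _.
pose BM := bilinear_isBilinear.Build R F1 F2 H *:%R *:%R B (lBl, lBr).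
pose B' : {bilinear F1 -> F2 -> H} := HB.pack B BM.
have BC : continuous (fun p => B' p.1 p.2) := bounded_bilinear_continuous.
have dB : is_diff (f x, g x) (fun p => B' p.1 p.2)
   (fun q => B' (f x) q.2 + B' q.1 (g x)).
  by split; [exact: differentiable_bilin|rewrite diff_bilin].
have := is_diff_comp (is_diff_pair dfx dgx) dB.
congr is_diff_def; apply/funext => v /=; exact: addrC.
Qed.

End Theory.
End Bilinear.

(** The derivative of x |-> B (f x) (g x) is a sum of two terms, each of which
    is again a bounded bilinear expression, with values in operators: one pairs
    the derivative of f with g, the other f with the derivative of g.  The lifts
    below are these two bilinear maps.  They also absorb one variable of a
    curried homogeneous polynomial placed in the first or second argument of B. *)
Section Lifts.
Context {R : realType} {E F1 F2 H : normedModType R}.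
Variables (B : F1 -> F2 -> H).

Definition bilin_liftl (a : blin E F1) (v : F2) : blin E H :=
  to_blin (fun w => B (a w) v).

Definition bilin_liftr (u : F1) (b : blin E F2) : blin E H :=
  to_blin (fun w => B u (b w)).

Hypothesis bB : bounded_bilinear B.

Lemma bilin_liftlE a v w : bilin_liftl a v w = B (a w) v.
Proof.
rewrite to_blinE//; case: bB => lB _ [M M0 MB]; split.
  by move=> c s t /=; rewrite linearP lB.
exists (M * `|a| * `|v|) => s; apply: le_trans (MB _ _) _.
rewrite -!mulrA ler_wpM2l// [`|v| * _]mulrC mulrA ler_wpM2r//.
exact: blin_norm_ub.
Qed.

Lemma bilin_liftrE u b w : bilin_liftr u b w = B u (b w).
Proof.
rewrite to_blinE//; case: bB => _ lB [M M0 MB]; split.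
  by move=> c s t /=; rewrite linearP lB.
exists (M * `|u| * `|b|) => s; apply: le_trans (MB _ _) _.
rewrite -!mulrA ler_wpM2l// ler_wpM2l//.
exact: blin_norm_ub.
Qed.

Lemma bounded_bilinear_liftl : bounded_bilinear bilin_liftl.
Proof.
case: (bB) => lBl lBr [M M0 MB]; split.
- move=> v c s t; apply: blinEP => w.
  by rewrite blinDE blinZE !bilin_liftlE blinDE blinZE lBl.
- move=> a c s t; apply: blinEP => w.
  by rewrite blinDE blinZE !bilin_liftlE lBr.
exists M => // a v; apply: blin_norm_le => [|w]; first by rewrite !mulr_ge0.
rewrite bilin_liftlE; apply: le_trans (MB _ _) _.
rewrite -!mulrA ler_wpM2l// [`|v| * _]mulrC mulrA ler_wpM2r//.
exact: blin_norm_ub.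
Qed.

Lemma bounded_bilinear_liftr : bounded_bilinear bilin_liftr.
Proof.
case: (bB) => lBl lBr [M M0 MB]; split.
- move=> v c s t; apply: blinEP => w.
  by rewrite blinDE blinZE !bilin_liftrE lBl.
- move=> a c s t; apply: blinEP => w.
  by rewrite blinDE blinZE !bilin_liftrE blinDE blinZE lBr.
exists M => // u b; apply: blin_norm_le => [|w]; first by rewrite !mulr_ge0.
rewrite bilin_liftrE; apply: le_trans (MB _ _) _.
rewrite -!mulrA ler_wpM2l// ler_wpM2l//.
exact: blin_norm_ub.
Qed.

End Lifts.

Section Evaluation.
Context {R : realType} {E F : normedModType R}.

Definition blin_eval (L : blin E F) (v : E) : F := L v.

Lemma bounded_bilinear_eval : bounded_bilinear blin_eval.
Proof.
split=> [v c s t|L c s t|]; rewrite /blin_eval.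
- by [].
- exact: linearP.
- by exists 1 => // L v; rewrite mul1r; exact: blin_norm_ub.
Qed.

End Evaluation.

(** * Maps of class C^k and the chain rule *)

Section ClassC.
Context {R : realType} {E : normedModType R}.
Implicit Types (F : normedModType R) (U : set E) (k : nat).

Lemma class_C_sub k F U V (f : E -> F) :
  V `<=` U -> class_C k U f -> class_C k V f.
Proof.
move=> VU; elim: k F f => [|k IH] F f /=; first by move=> fU x /VU /fU.
case=> -[df cdf] ckf; split; last exact: IH.
by split=> x /VU; [exact: df|exact: cdf].
Qed.

Lemma class_CS_is_diff k F U (f : E -> F) : class_C k.+1 U f ->
  (forall x, U x -> is_diff x f (fderiv f x)) /\ class_C k U (fderiv f).
Proof. by case=> -[df _] ?; split=> // x /df /is_diff_fderiv. Qed.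

Lemma class_C_continuous k F U (f : E -> F) : class_C k U f -> class_C0 U f.
Proof.
by case: k => [//|k] [[df _] _] x /df; exact: differentiable_continuous.
Qed.

Lemma class_CW k F U (f : E -> F) : class_C k.+1 U f -> class_C k U f.
Proof.
elim: k F f => [|k IH] F f; first exact: class_C_continuous.
by case=> ? /IH.
Qed.

(** On an open set equality of maps is equality of germs at every point, so it
    passes to derivatives of all orders. *)
Lemma class_C_eq k F U (f g : E -> F) : open U -> {in U, f =1 g} ->
  class_C k U f -> class_C k U g.
Proof.
move=> oU; elim: k F f g => [|k IH] F f g fg.
  move=> fC x Ux; have := fC x Ux; rewrite /prop_for /continuous_at.
  rewrite fg ?inE//; apply: cvg_trans; apply: near_eq_cvg.
  have := open_nbhs_nbhs (conj oU Ux); apply: filterS => y Uy.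
  by rewrite fg ?inE.
move=> Cf; have [df ckf] := class_CS_is_diff Cf.
have dg x : U x -> is_diff x g (fderiv f x).
  move=> Ux; apply: near_eq_is_diff (df _ Ux).
  have := open_nbhs_nbhs (conj oU Ux); apply: filterS => y Uy.
  by rewrite fg ?inE.
have ckg : class_C k U (fderiv g).
  apply: IH ckf => x; rewrite inE => /dg /fderiv_eq -> //.
split=> //; split; last exact: class_C_continuous ckg.
by move=> x /dg[].
Qed.

(** Replaces [fderiv f], which is defined through a choice of differential, by an
    explicit formula D for the derivative. *)
Lemma class_CS_intro k F U (f : E -> F) (D : E -> blin E F) : open U ->
  (forall x, U x -> is_diff x f (D x)) -> class_C k U D -> class_C k.+1 U f.
Proof.
move=> oU df CD.
have ck : class_C k U (fderiv f).
  apply: class_C_eq oU _ CD => x; rewrite inE => /df /fderiv_eq -> //.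
split=> //; split; last exact: class_C_continuous ck.
by move=> x /df[].
Qed.

Lemma class_CD k F U (f g : E -> F) : open U ->
  class_C k U f -> class_C k U g -> class_C k U (fun x => f x + g x).
Proof.
move=> oU; elim: k F f g => [|k IH] F f g.
  by move=> cf cg x Ux; apply: cvgD; [exact: cf|exact: cg].
move=> /class_CS_is_diff[df cf] /class_CS_is_diff[dg cg].
apply: class_CS_intro oU _ (IH _ _ _ cf cg) => x Ux.
exact: is_diffD (df _ Ux) (dg _ Ux).
Qed.

(** Each derivative is a sum of two bilinear expressions in maps of class C^k;
    the spaces and B change at each step, hence the induction is over all of
    them. *)
Lemma class_C_bilinear k (F1 F2 H : normedModType R) (B : F1 -> F2 -> H) U
    (f : E -> F1) (g : E -> F2) : open U -> bounded_bilinear B ->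
  class_C k U f -> class_C k U g -> class_C k U (fun x => B (f x) (g x)).
Proof.
move=> oU; elim: k F1 F2 H B f g => [|k IH] F1 F2 H B f g bB.
  move=> cf cg x Ux.
  have cfg : (fun y => (f y, g y)) @ x --> (f x, g x).
    by apply: cvg_pair; [exact: cf|exact: cg].
  exact: (cvg_comp _ _ cfg (@bounded_bilinear_continuous _ _ _ _ _ bB _)).
move=> Cf Cg; have [df cf] := class_CS_is_diff Cf.
have [dg cg] := class_CS_is_diff Cg.
have Cl := IH _ _ _ _ _ _ (bounded_bilinear_liftl bB) cf (class_CW Cg).
have Cr := IH _ _ _ _ _ _ (bounded_bilinear_liftr bB) (class_CW Cf) cg.
apply: class_CS_intro oU _ (class_CD oU Cl Cr) => x Ux.
have := is_diff_bilinear bB (df _ Ux) (dg _ Ux).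
congr is_diff_def; apply/funext => v.
by rewrite blinDE bilin_liftlE ?bilin_liftrE.
Qed.

End ClassC.

(** The derivative of the composite is the operator composition of
    fderiv g \o f and fderiv f; composition of operators is the right lift of
    the evaluation map. *)
Lemma class_C_comp (R : realType) k (E F G : normedModType R) (U : set E) (V : set F)
    (f : E -> F) (g : F -> G) : open U -> (forall x, U x -> V (f x)) ->
  class_C k U f -> class_C k V g -> class_C k U (g \o f).
Proof.
move=> oU fUV; elim: k G g => [|k IH] G g.
  by move=> cf cg x Ux; apply: continuous_comp; [exact: cf|exact/cg/fUV].
move=> Cf Cg; have [df cf] := class_CS_is_diff Cf.
have [dg cg] := class_CS_is_diff Cg.
have := class_C_bilinear oU (bounded_bilinear_liftr
  (@bounded_bilinear_eval _ F G)) (IH _ _ (class_CW Cf) cg) cf.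
apply: class_CS_intro oU _ => x Ux.
have := is_diff_comp (df _ Ux) (dg _ (fUV _ Ux)).
congr is_diff_def; apply/funext => v /=.
by rewrite bilin_liftrE//; exact: bounded_bilinear_eval.
Qed.

(** * Taylor's formula with Peano remainder *)

Section MeanValue.
Context {R : realType} {F : normedModType R}.

(** For vector-valued h there is no intermediate point, so the argument goes
    through the function w s = |h b - h s| + (M + e) s.  At a maximum point c < b
    a small step to the right would increase w, since the first term decreases
    at rate at most about M; so the maximum is at b, and w a <= w b is the
    inequality with slack e. *)
Lemma mean_value_inequality (h dh : R -> F) (a b M : R) : a <= b ->
  (forall s, a <= s <= b -> is_derive s 1 h (dh s)) ->
  (forall s, a <= s <= b -> `|dh s| <= M) ->
  `|h b - h a| <= M * (b - a).
Proof.
move=> ab dhE dhM.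
suff slack e : 0 < e -> `|h b - h a| <= (M + e) * (b - a).
  move: ab; rewrite le_eqVlt => /predU1P[<-|ab].
    by rewrite !subrr normr0 mulr0.
  apply/ler_addgt0Pr => e e0; have := slack (e / (b - a)).
  rewrite divr_gt0 ?subr_gt0// mulrDl divfK ?subr_eq0 ?gt_eqF//; exact.
move=> e0; pose w s := `|h b - h s| + (M + e) * s.
have cw : {within `[a, b], continuous w}.
  apply/continuous_in_subspaceT => s; rewrite inE/= in_itv/= => /dhE[ds _].
  have ch : {for s, continuous h}.
    by apply/differentiable_continuous/derivable1_diffP.
  apply: cvgD; last by apply: cvgM; [exact: cvg_cst|exact: cvg_id].
  by apply: cvg_norm; apply: cvgB; [exact: cvg_cst|exact: ch].
have [c] := EVT_max ab cw; rewrite in_itv/= => /andP[ac].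
rewrite le_eqVlt => /predU1P[-> /(_ a)|cb maxc].
  rewrite in_itv/= lexx ab => /(_ isT).
  by rewrite /w subrr normr0 add0r -lerBrDr -mulrBr.
have acb : a <= c <= b by rewrite ac ltW.
have [dc dhc] := dhE _ acb.
have : \forall t \near 0^', `|t^-1 *: (h (t *: 1 + c) - h c)| < M + e.
  have /cvgr_norm_lt : t^-1 *: (h (t *: 1 + c) - h c) @[t --> 0^'] --> dh c.
    by rewrite -dhc; exact: dc.
  by apply; rewrite (le_lt_trans (dhM _ acb))// ltrDl.
case/nbhs_ballP => d /= d0 dP; pose t := Num.min (d / 2) (b - c).
have t0 : 0 < t by rewrite lt_min divr_gt0// subr_gt0.
have tbc : t <= b - c by rewrite ge_min lexx orbT.
have td : t < d.
  by rewrite gt_min ltr_pdivrMr// mulr_natr mulr2n ltrDl d0.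
have := dP t; rewrite /ball/= sub0r normrN gtr0_norm// => /(_ td (lt0r_neq0 t0)).
rewrite normrZ normfV gtr0_norm// ltr_pdivrMl// => ht.
have tc : h (t *: 1 + c) = h (t + c) by rewrite [t *: 1]mulr1.
have := maxc (t + c); rewrite in_itv/= -lerBrDr tbc (le_trans ac) ?lerDr ?(ltW t0)//.
move=> /(_ isT); rewrite leNgt /w => /negP[].
have: `|h b - h c| <= `|h b - h (t + c)| + `|h (t + c) - h c|.
  by rewrite (le_trans _ (ler_normD _ _))// subrKA.
rewrite tc in ht; lra.
Qed.

Lemma is_derive_scalel (g : R -> R) (s dg : R) (d : F) :
  is_derive s 1 g dg -> is_derive s 1 (fun t => g t *: d) (dg *: d).
Proof.
case=> dgs <-.
have cg : t^-1 *: (g (t *: 1 + s) *: d - g s *: d) @[t --> 0^'] -->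
          'D_1 g s *: d.
  rewrite (_ : (fun t => _) =
    fun t => (t^-1 *: (g (t *: 1 + s) - g s)) *: d).
    by apply: cvgZr_tmp; exact: dgs.
  by apply/funext => t; rewrite -scalerBl scalerA.
by split; [apply/cvg_ex; eexists; exact: cg|exact: cvg_lim cg].
Qed.

End MeanValue.

Section Peano.
Context {R : realType} {E : normedModType R}.
Implicit Types F : normedModType R.

Lemma is_derive_line F (f : E -> F) (x w : E) (s : R) :
  differentiable f (s *: w + x) ->
  is_derive s 1 (fun t : R => f (t *: w + x)) (fderiv f (s *: w + x) w).
Proof.
move=> df; rewrite fderivE// -deriveE//.
have E1 : (fun t : R => t^-1 *: (f ((t *: 1 + s) *: w + x) - f (s *: w + x))) =
    (fun t : R => t^-1 *: (f (t *: w + (s *: w + x)) - f (s *: w + x))).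
  by apply/funext => t; rewrite [t *: 1]mulr1 scalerDl addrA.
have /= := diff_derivable (v := w) df; rewrite /derivable => dfw.
split; first by rewrite /derivable E1.
by rewrite /derive E1.
Qed.

Lemma dern_homog F l (f : E -> F) (x v : E) (s : R) :
  dern f x (fun _ : 'I_l => s *: v) = s ^+ l *: dern f x (fun _ : 'I_l => v).
Proof.
elim: l F f => [|l IH] F f /=; first by rewrite scale1r.
by rewrite IH blinZE linearZ scalerA -exprSr.
Qed.

(** The Taylor polynomial with its constant term: this is what the derivative of
    a Taylor polynomial produces, see [is_derive_taylor]. *)
Definition taylor F k (f : E -> F) (x v : E) : F :=
  \sum_(l < k.+1) (l`!%:R)^-1 *: dern f x (fun _ : 'I_l => v).

Lemma taylorE F k (f : E -> F) x v : taylor k f x v = f x + taylor_red k f x v.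
Proof.
rewrite /taylor -(big_mkord xpredT
  (fun l => (l`!%:R)^-1 *: dern f x (fun _ : 'I_l => v))).
by rewrite big_ltn//= invr1 scale1r.
Qed.

Lemma taylor0 F k (f : E -> F) x : taylor k f x 0 = f x.
Proof.
rewrite taylorE /taylor_red big_nat big1 ?addr0// => -[//|l] _.
by rewrite -(scale0r 0) dern_homog exprS mul0r scale0r scaler0.
Qed.

Lemma blin_sumE F n (f : 'I_n -> blin E F) v :
  (\sum_i f i) v = \sum_i f i v.
Proof.
by elim/big_ind2: _ => // L1 u1 L2 u2 <- <-.
Qed.

(** Along a ray the derivative of the Taylor polynomial of f is the Taylor
    polynomial, one order lower, of the derivative of f: on the ray each term is
    t ^+ l times a constant vector, and [dern] at order l.+1 is by definition
    [dern] of [fderiv f] at order l applied to the last vector. *)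
Lemma is_derive_taylor F k (f : E -> F) (x w : E) (s : R) :
  is_derive s 1 (fun t : R => taylor k.+1 f x (t *: w))
    (taylor k (fderiv f) x (s *: w) w).
Proof.
pose c l : F := dern f x (fun _ : 'I_l => w).
have -> : (fun t : R => taylor k.+1 f x (t *: w)) =
    \sum_(l < k.+2) (fun t : R => t ^+ l *: ((l`!%:R)^-1 *: c l)).
  apply/funext => t; rewrite fct_sumE; apply: eq_bigr => l _.
  by rewrite dern_homog !scalerA mulrC.
have -> : taylor k (fderiv f) x (s *: w) w =
    \sum_(l < k.+2) (l%:R * s ^+ l.-1) *: ((l`!%:R)^-1 *: c l).
  rewrite big_ord_recl mul0r scale0r add0r blin_sumE; apply: eq_bigr => l _.
  rewrite blinZE dern_homog blinZE lift0 /= !scalerA; congr (_ *: _).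
  rewrite factS natrM invfM mulrACA mulfV ?mul1r ?pnatr_eq0// mulrC //.
apply: is_derive_sum => l; apply: is_derive_scalel.
split; first exact: exprn_derivable.
by rewrite exp_derive [LHS]mulr1.
Qed.

(** Taylor's formula with Peano remainder, by induction on k: the remainder of f
    on the segment from x to x + w has as derivative the remainder of [fderiv f],
    applied to w.  The latter is at most e |w|^k in operator norm, and the mean
    value inequality on [0, 1] gives e |w|^k.+1. *)
Lemma taylor_peano F k U (f : E -> F) (x : E) : open U -> U x ->
  class_C k U f -> forall e : R, 0 < e ->
  \forall w \near 0, `|f (w + x) - taylor k f x w| <= e * `|w| ^+ k.
Proof.
move=> oU Ux; elim: k F f => [|k IH] F f Cf e e0.
  have H : \forall t \near x, `|f x - f t| <= e.
    by have /cvgrPdist_le := Cf x Ux; exact.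
  rewrite (near_shift 0) in H.
  apply: filterS H => w; rewrite /= subr0 distrC expr0 mulr1.
  by rewrite taylorE /taylor_red big_geq// addr0.
have [df cf] := class_CS_is_diff Cf.
have /nbhs_ballP[d1 /= d10 Hd1] := IH _ _ cf _ e0.
have /nbhs_ballP[d2 /= d20 Hd2] := open_nbhs_nbhs (conj oU Ux).
near=> w.
have wd (s : R) : 0 <= s <= 1 -> `|s *: w| < d1 /\ `|s *: w| < d2.
  move=> /andP[s0 s1]; have sw : `|s *: w| <= `|w|.
    by rewrite normrZ ger0_norm// ler_piMl.
  by split; apply: le_lt_trans sw _; near: w; exact: nbhs0_lt.
pose r (s : R) := f (s *: w + x) - taylor k.+1 f x (s *: w).
pose dr (s : R) := (fderiv f (s *: w + x) - taylor k (fderiv f) x (s *: w)) w.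
have drE (s : R) : 0 <= s <= 1 -> is_derive s 1 r (dr s).
  move=> /wd[_ wd2]; apply: is_deriveB (is_derive_taylor _ _ _ _ _).
  apply: is_derive_line.
  have /df[//] : U (s *: w + x).
  by apply: Hd2; rewrite -ball_normE/= opprD addrCA subrr addr0 normrN.
have drM (s : R) : 0 <= s <= 1 -> `|dr s| <= e * `|w| ^+ k.+1.
  move=> s01; have [wd1 _] := wd _ s01; case/andP: s01 => s0 s1.
  apply: le_trans (blin_norm_ub _ _) _; rewrite exprSr mulrA ler_wpM2r//.
  have /= := Hd1 (s *: w); rewrite -ball_normE/= sub0r normrN => /(_ wd1) H.
  apply: le_trans H _; rewrite ler_pM2l// lerXn2r ?nnegrE//.
  by rewrite normrZ ger0_norm// ler_piMl.
have := mean_value_inequality ler01 drE drM.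
by rewrite /r !scale1r scale0r add0r taylor0 !subrr !subr0 mulr1.
Unshelve. all: by end_near. Qed.

End Peano.

(** * Polynomials in curried form *)

Section Curried.
Context {R : realType} {E : normedModType R}.
Implicit Types F G H : normedModType R.

Fixpoint curried_homogeneous (j : nat) F (p : E -> F) : Prop :=
  match j with
  | 0 => exists c, p = fun=> c
  | j'.+1 => exists2 c : E -> blin E F, curried_homogeneous j' c &
               p = fun v => c v v
  end.

Lemma curried_homogeneous0 j F : curried_homogeneous j (0 : E -> F).
Proof. by elim: j F => [|j IH] F /=; [exists 0|exists 0]. Qed.

Lemma curried_homogeneousD j F (p q : E -> F) : curried_homogeneous j p ->
  curried_homogeneous j q -> curried_homogeneous j (p + q).
Proof.
elim: j F p q => [|j IH] F p q /=; first by move=> [c ->] [d ->]; exists (c + d).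
by move=> [c hc ->] [d hd ->]; exists (c + d); first exact: IH.
Qed.

(** Absorb the degree of q first, with p constant, through the right lift; then
    the degree of p through the left lift. *)
Lemma curried_homogeneous_bilinear i j F G H (B : F -> G -> H) p q :
  bounded_bilinear B -> curried_homogeneous i p -> curried_homogeneous j q ->
  curried_homogeneous (i + j) (fun v : E => B (p v) (q v)).
Proof.
move=> bB; elim: i F G H B p q bB => [|i IHi] F G H B p q bB /=.
  move=> [a ->{p}]; elim: j G H B q bB => [|j IHj] G H B q bB /=.
    by move=> [b ->]; exists (B a b).
  move=> [c hc ->]; exists (fun v => bilin_liftr B a (c v)).
    exact: (IHj _ _ _ _ (bounded_bilinear_liftr bB) hc).
  by apply/funext => v; rewrite bilin_liftrE.
move=> [c hc ->] hq; exists (fun v => bilin_liftl B (c v) (q v)).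
  exact: (IHi _ _ _ _ _ _ (bounded_bilinear_liftl bB) hc hq).
by apply/funext => v; rewrite bilin_liftlE.
Qed.

Lemma curried_homogeneousZ j F (a : R) (p : E -> F) : curried_homogeneous j p ->
  curried_homogeneous j (fun v => a *: p v).
Proof.
elim: j F p => [|j IH] F p /=; first by move=> [c ->]; exists (a *: c).
by move=> [c hc ->]; exists (fun v => a *: c v); first exact: IH.
Qed.

Lemma curried_homogeneous_dern l F (f : E -> F) x :
  curried_homogeneous l (fun v => dern f x (fun _ : 'I_l => v)).
Proof.
elim: l F f => [|l IH] F f /=; first by exists (f x).
by exists (fun v => dern (fderiv f) x (fun _ : 'I_l => v)).
Qed.

(** Uncurrying.  The last vector is consumed by the outermost operator, as in
    [dern]. *)
Lemma curried_homogeneous_multilinear j F (p : E -> F) :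
  curried_homogeneous j p ->
  exists A : ('I_j -> E) -> F,
    [/\ forall v i, linear (fun u : E => A (dfwith v i u)),
        exists2 M : R, 0 <= M & forall v, `|A v| <= M * \prod_(i < j) `|v i| &
        forall v, p v = A (fun=> v)].
Proof.
elim: j F p => [|j IH] F p /=.
  move=> [c ->]; exists (fun=> c); split=> //; first by move=> v [].
  by exists `|c| => // v; rewrite big_ord0 mulr1.
move=> [c /IH[A [lA [M M0 MA] cA]] ->].
pose inner (v : 'I_j.+1 -> E) (i : 'I_j) := v (widen_ord (leqnSn j) i).
exists (fun v => A (inner v) (v ord_max)); split=> [v i|| v]; last 1 first.
- by rewrite cA.
- have [-> a u u'|[i' ->]] : i = ord_max \/ exists i', i = widen_ord (leqnSn j) i'.
    by case: (unliftP ord_max i) => [i'|] ->; [right; exists i'|left];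
      apply/val_inj; rewrite //= /bump leqNgt ltn_ord.
    have E1 w : inner (dfwith v ord_max w) = inner v.
      apply/funext => m; rewrite /inner dfwithout// -val_eqE /=.
      by rewrite gtn_eqF.
    by rewrite !E1 !dfwithin linearP.
  move=> a u u'.
  have E1 w : inner (dfwith v (widen_ord (leqnSn j) i') w) =
      dfwith (inner v) i' w.
    apply/funext => m; rewrite /inner.
    have [->|mi] := eqVneq i' m; first by rewrite !dfwithin.
    by rewrite !dfwithout.
  have E2 w : dfwith v (widen_ord (leqnSn j) i') w ord_max = v ord_max.
    by rewrite dfwithout// -val_eqE /= ltn_eqF.
  by rewrite !E1 !E2 lA.
exists M => // v; rewrite big_ord_recr /= mulrA.
by apply: le_trans (blin_norm_ub _ _) _; rewrite ler_wpM2r// MA.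
Qed.

(** Summing the multilinear form over all permutations of its arguments makes it
    symmetric and multiplies its diagonal by j`!, the factor that
    [homogeneous_poly] divides by. *)
Lemma curried_homogeneous_poly j F (p : E -> F) :
  curried_homogeneous j p -> homogeneous_poly j p.
Proof.
move=> /curried_homogeneous_multilinear[A [lA [M M0 MA] pA]].
exists (fun v => \sum_(s : 'S_j) A (v \o s)); last first.
  apply/funext => v; rewrite (eq_bigr (fun=> p v)) => [|s _]; last by rewrite pA.
  by rewrite sumr_const card_Sn -[p v *+ _]scaler_nat scalerA mulVf ?scale1r//.
split.
- move=> v i a u w /=; rewrite scaler_sumr -big_split; apply: eq_bigr => s _ /=.
  have E1 z : dfwith v i z \o s = dfwith (v \o s) (s^-1%g i) z.
    apply/funext => m /=; have [<-|im] := eqVneq (s^-1%g i) m.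
      by rewrite permKV !dfwithin.
    by rewrite !dfwithout//; apply: contraNneq im => ->; rewrite permK.
  by rewrite !E1 lA.
- move=> s v; rewrite [RHS](reindex_inj (mulIg s)) /=.
  by apply: eq_bigr => t _; congr A; apply/funext => i /=; rewrite permM.
exists (j`!%:R * M) => v.
rewrite -mulrA mulr_natl -card_Sn -sumr_const.
apply: le_trans (ler_norm_sum _ _ _) _; apply: ler_sum => s _.
apply: le_trans (MA _) _; rewrite ler_wpM2l//.
by rewrite [leRHS](reindex_inj (@perm_inj _ s)).
Qed.

(** Sums are built into the definition so that closure properties follow by
    structural induction; components of equal degree are collected only in
    [curried_poly_decomp]. *)
Inductive curried_poly F : (E -> F) -> Prop :=
| CurriedHomogeneous j p : curried_homogeneous j p -> curried_poly p
| CurriedAdd p q : curried_poly p -> curried_poly q -> curried_poly (p + q).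

Lemma curried_poly_bilinear F G H (B : F -> G -> H) p q :
  bounded_bilinear B -> curried_poly p -> curried_poly q ->
  curried_poly (fun v => B (p v) (q v)).
Proof.
move=> bB; elim=> {p}[i p hp|p p' _ IHp _ IHp' hq]; last first.
  rewrite (_ : (fun v => _) =
    (fun v => B (p v) (q v)) + (fun v => B (p' v) (q v))).
    by apply: CurriedAdd; [exact: IHp|exact: IHp'].
  by apply/funext => v; exact: (bounded_bilinearDl bB).
elim=> {q}[j q hq|q q' _ IHq _ IHq'].
  exact: CurriedHomogeneous (curried_homogeneous_bilinear bB hp hq).
rewrite (_ : (fun v => _) = (fun v => B (p v) (q v)) + (fun v => B (p v) (q' v))).
  exact: CurriedAdd.
by apply/funext => v; exact: (bounded_bilinearDr bB).
Qed.

Lemma curried_poly_taylor_red k F (f : E -> F) x :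
  curried_poly (taylor_red k f x).
Proof.
rewrite (_ : taylor_red k f x = \sum_(1 <= l < k.+1)
    (fun v => (l`!%:R)^-1 *: dern f x (fun _ : 'I_l => v))); last first.
  by apply/funext => v; rewrite fct_sumE.
apply: big_ind => [||l _].
- exact: CurriedHomogeneous (curried_homogeneous0 0 F).
- exact: CurriedAdd.
exact/CurriedHomogeneous/curried_homogeneousZ/curried_homogeneous_dern.
Qed.

(** Components are added degree by degree; the two decompositions are first
    padded with zeros to a common length. *)
Lemma curried_poly_decomp F (p : E -> F) : curried_poly p ->
  exists c, homogeneous_decomp p c.
Proof.
suff H : curried_poly p -> exists c : nat -> E -> F,
    (forall j, curried_homogeneous j (c j)) /\
    exists n : nat, (forall j, (n <= j)%N -> c j = 0) /\
      p = fun v => \sum_(j < n) c j v.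
  by move=> /H[c [hc cn]]; exists c; split=> // j; exact: curried_homogeneous_poly.
elim=> {p}[i p hp|p q _ [c [hc [n [cn ->]]]] _ [d [hd [m [dm ->]]]]].
  exists (fun j => if j == i then p else 0); split=> [j|].
    by case: eqP => [->//|_]; exact: curried_homogeneous0.
  exists i.+1; split=> [j ij|]; first by rewrite gtn_eqF.
  apply/funext => v; rewrite big_ord_recr /= eqxx big1 ?add0r// => j _.
  by rewrite ltn_eqF.
exists (fun j => c j + d j); split=> [j|]; first exact: curried_homogeneousD.
have pad (e : nat -> E -> F) N N' v : (forall j, (N <= j)%N -> e j = 0) ->
    (N <= N')%N -> \sum_(j < N) e j v = \sum_(j < N') e j v.
  move=> eN NN'; rewrite (big_ord_widen _ (fun j => e j v) NN') big_mkcond.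
  by apply: eq_bigr => j _; case: ltnP => // /eN ->.
exists (n + m)%N; split=> [j nmj|].
  by rewrite cn ?dm ?addr0//; apply: leq_trans nmj; rewrite ?leq_addl ?leq_addr.
apply/funext => v; rewrite /= big_split /=.
by rewrite -(pad c n)// ?leq_addr// -(pad d m)// leq_addl.
Qed.

(** From c u u - c v v = c u (u - v) + (c u - c v) v, where c is itself Lipschitz
    on the unit ball and hence bounded there by |c 0| plus its constant. *)
Lemma curried_homogeneous_lipschitz j F (p : E -> F) : curried_homogeneous j p ->
  exists2 C : R, 0 <= C &
    forall u v, `|u| <= 1 -> `|v| <= 1 -> `|p u - p v| <= C * `|u - v|.
Proof.
elim: j F p => [|j IH] F p /=.
  by move=> [c ->]; exists 0 => // u v _ _; rewrite subrr normr0 mul0r.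
move=> [c /IH[C C0 cC] ->]; exists (`|c 0| + C + C) => [|u v u1 v1].
  by rewrite !addr_ge0.
have -> : c u u - c v v = c u (u - v) + (c u - c v) v.
  by rewrite linearB blinDE blinNE subrKA.
apply: le_trans (ler_normD _ _) _; rewrite mulrDl; apply: lerD.
  apply: le_trans (blin_norm_ub _ _) _; rewrite ler_wpM2r//.
  have -> : c u = c 0 + (c u - c 0) by rewrite addrC subrK.
  apply: le_trans (ler_normD _ _) _; rewrite lerD2l.
  apply: le_trans (cC _ _ u1 _) _; first by rewrite normr0.
  by rewrite subr0 ler_piMr.
apply: le_trans (blin_norm_ub _ _) _; apply: le_trans (cC _ _ u1 v1).
by rewrite ler_piMr.
Qed.

Lemma curried_poly_lipschitz F (p : E -> F) : curried_poly p ->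
  exists2 C : R, 0 <= C &
    forall u v, `|u| <= 1 -> `|v| <= 1 -> `|p u - p v| <= C * `|u - v|.
Proof.
elim=> {p}[j p|p q _ [C C0 pC] _ [D D0 qD]].
  exact: curried_homogeneous_lipschitz.
exists (C + D) => [|u v u1 v1]; first exact: addr_ge0.
rewrite mulrDl /= opprD addrACA; apply: le_trans (ler_normD _ _) _.
by rewrite lerD ?pC ?qD.
Qed.

End Curried.

(** If q w = c w w, then q \o p is the evaluation map applied to c \o p and p, and
    c \o p is polynomial by induction on the degree. *)
Lemma curried_poly_comp (R : realType) (E F G : normedModType R)
    (p : E -> F) (q : F -> G) :
  curried_poly p -> curried_poly q -> curried_poly (q \o p).
Proof.
move=> hp; elim=> {q}[l q|q q' _ IHq _ IHq']; last exact: CurriedAdd.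
elim: l G q => [|l IH] G q /=.
  by move=> [c ->]; apply: (@CurriedHomogeneous _ _ _ 0); exists c.
move=> [c /IH hc ->].
exact: (curried_poly_bilinear (@bounded_bilinear_eval _ F G) hc hp).
Qed.

(** * Vector-valued polynomials in one variable that are o(t^k) *)

Section LittlePower.
Context {R : realType} {F : normedModType R}.
Implicit Types (g h : R -> F) (k : nat).

Definition littleo_power k g : Prop :=
  forall e : R, 0 < e -> \forall t \near 0^'+, `|g t| <= e * t ^+ k.

Lemma littleo_powerD k g h :
  littleo_power k g -> littleo_power k h -> littleo_power k (fun t => g t + h t).
Proof.
move=> sg sh e e0; have e20 : 0 < e / 2 by rewrite divr_gt0.
apply: filterS2 (sg _ e20) (sh _ e20) => t gt ht.
by apply: le_trans (ler_normD _ _) _; rewrite [e]splitr mulrDl lerD.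
Qed.

Lemma littleo_powerN k g : littleo_power k g -> littleo_power k (fun t => - g t).
Proof.
by move=> sg e /sg; apply: filterS => t; rewrite normrN.
Qed.

Lemma littleo_powerW k g : littleo_power k g -> littleo_power 0 g.
Proof.
move=> sg e e0; near=> t.
have t0 : 0 < t by near: t; exact: nbhs_right_gt.
have t1 : t < 1 by near: t; exact: nbhs_right_lt.
apply: (@le_trans _ _ (e * t ^+ k)); first by near: t; exact: sg.
by rewrite ler_pM2l// expr0 exprn_ile1// ltW.
Unshelve. all: by end_near. Qed.

(** For 0 < t < 1 the sum is at most t ^+ k.+1 times the sum C of the norms of the
    coefficients. *)
Lemma littleo_power_tail k n (a : nat -> F) :
  littleo_power k (fun t => \sum_(l < n) t ^+ (k.+1 + l) *: a l).
Proof.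
move=> e e0; pose C := \sum_(l < n) `|a l|.
have C0 : 0 <= C by exact: sumr_ge0.
near=> t.
have t0 : 0 < t by near: t; exact: nbhs_right_gt.
have t1 : t < 1 by near: t; exact: nbhs_right_lt.
have te : t < e / (C + 1).
  by near: t; apply: nbhs_right_lt; rewrite divr_gt0// ltr_wpDl.
apply: (@le_trans _ _ (C * t ^+ k.+1)).
  rewrite mulr_suml; apply: le_trans (ler_norm_sum _ _ _) _.
  apply: ler_sum => l _; rewrite normrZ mulrC ler_wpM2l// gtr0_norm ?exprn_gt0//.
  by rewrite exprD ler_piMr ?exprn_ge0 ?exprn_ile1 ?ltW.
rewrite exprS mulrA ler_wpM2r ?exprn_ge0 ?(ltW t0)//.
apply: (@le_trans _ _ ((C + 1) * t)); first by rewrite ler_wpM2r ?(ltW t0)// lerDl.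
by rewrite mulrC -ler_pdivlMr ?ltr_wpDl// ltW.
Unshelve. all: by end_near. Qed.

(** Removing the terms of positive degree, which are o(1), shows that the constant
    a 0 is o(1). *)
Lemma littleo_power_poly_cst0 k n (a : nat -> F) :
  littleo_power k (fun t => \sum_(l < n.+1) t ^+ l *: a l) -> a 0%N = 0.
Proof.
move=> sa; apply/eqP; rewrite -normr_le0; apply/ler_addgt0Pr => e e0.
rewrite add0r; near (0 : R)^'+ => t.
suff : `|\sum_(l < n.+1) t ^+ l *: a l -
         \sum_(l < n) t ^+ (1 + l) *: a l.+1| <= e * t ^+ 0.
  by rewrite big_ord_recl expr0 scale1r mulr1 addrK.
near: t; exact: (littleo_powerD (littleo_powerW sa)
  (littleo_powerN (@littleo_power_tail 0 n (fun l => a l.+1))) e0).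
Unshelve. all: by end_near. Qed.

(** Once a 0 = 0 the sum is divisible by t, and dividing lowers k by one. *)
Lemma littleo_power_poly_eq0 k (a : nat -> F) :
  littleo_power k (fun t => \sum_(l < k.+1) t ^+ l *: a l) ->
  forall l, (l <= k)%N -> a l = 0.
Proof.
elim: k a => [|k IH] a sa; have a0 := littleo_power_poly_cst0 sa.
  by move=> l; rewrite leqn0 => /eqP ->.
case=> [//|l]; rewrite ltnS; apply: (IH (fun l => a l.+1)) => e e0; near=> t.
have t0 : 0 < t by near: t; exact: nbhs_right_gt.
have : `|\sum_(l < k.+2) t ^+ l *: a l| <= e * t ^+ k.+1 by near: t; exact: sa.
rewrite big_ord_recl a0 scaler0 add0r.
under eq_bigr do rewrite lift0 exprS -scalerA.
by rewrite -scaler_sumr normrZ gtr0_norm// exprS mulrCA ler_pM2l.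
Unshelve. all: by end_near. Qed.

End LittlePower.

(** * Comparison of the Taylor expansions along a ray *)

Section AlongLine.
Context {R : realType} {E : normedModType R}.
Implicit Types F : normedModType R.

Lemma ray_cvg0 (v : E) : t *: v @[t --> (0 : R)^'+] --> (0 : E).
Proof.
apply: cvg_at_right_filter; rewrite -[X in _ --> X](scale0r v).
by apply: cvgZr_tmp; exact: cvg_id.
Qed.

Lemma ray_cvg (x v : E) : t *: v + x @[t --> (0 : R)^'+] --> x.
Proof.
rewrite -[X in _ --> X]add0r; apply: cvgD; [exact: ray_cvg0|exact: cvg_cst].
Qed.

Lemma taylor_peano_line F k U (f : E -> F) (x v : E) : open U -> U x ->
  class_C k U f ->
  littleo_power k (fun t : R => f (t *: v + x) - taylor k f x (t *: v)).
Proof.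
move=> oU Ux Cf e e0.
have v0 : 0 < `|v| ^+ k + 1 by rewrite ltr_wpDl ?exprn_ge0.
have e'0 : 0 < e / (`|v| ^+ k + 1) by rewrite divr_gt0.
near=> t.
have t0 : 0 < t by near: t; exact: nbhs_right_gt.
have : `|f (t *: v + x) - taylor k f x (t *: v)| <=
    e / (`|v| ^+ k + 1) * `|t *: v| ^+ k.
  by near: t; exact: (@ray_cvg0 v) _ (taylor_peano oU Ux Cf e'0).
move/le_trans; apply; rewrite normrZ gtr0_norm// exprMn mulrCA mulrC.
rewrite ler_wpM2r ?exprn_ge0 ?(ltW t0)// mulrAC ler_pdivrMr//.
by rewrite ler_pM2l// lerDl.
Unshelve. all: by end_near. Qed.

(** Homogeneous components of the reduced Taylor polynomial, the one of degree 0
    being 0, so that sums over all degrees l <= k line up with those of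
    [trunc_deg]. *)
Definition taylor_coef F (f : E -> F) (x : E) (l : nat) (v : E) : F :=
  if l == 0%N then 0 else (l`!%:R)^-1 *: dern f x (fun _ : 'I_l => v).

Lemma taylor_red_coef F k (f : E -> F) x (t : R) v :
  taylor_red k f x (t *: v) = \sum_(l < k.+1) t ^+ l *: taylor_coef f x l v.
Proof.
rewrite /taylor_red -(big_mkord xpredT (fun l => t ^+ l *: taylor_coef f x l v)).
rewrite [RHS]big_ltn// scaler0 add0r; apply: eq_big_nat => -[//|l] _.
by rewrite dern_homog /taylor_coef !scalerA mulrC.
Qed.

Lemma taylor_red0 F k (f : E -> F) x : taylor_red k f x 0 = 0.
Proof. by apply: (addrI (f x)); rewrite -taylorE taylor0 addr0. Qed.

End AlongLine.

(** Write u t = phi (x + t v) - phi x and q t for the reduced Taylor polynomial of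
    phi at t v.  The error splits in two.  Replacing psi by its Taylor polynomial
    at u t costs o(|u t|^k), which is o(t^k) because
    |u t|^k = O(t^k).  Replacing u t by q t in that polynomial costs
    O(|u t - q t|), which is o(t^k) by Taylor's formula for phi. *)
Lemma taylor_comp_line (R : realType) (E F G : normedModType R) (k : nat)
    (U : set E) (V : set F) (phi : E -> F) (psi : F -> G) (x v : E) :
  open U -> open V -> class_C k U phi -> class_C k V psi -> U x -> V (phi x) ->
  littleo_power k (fun t : R => psi (phi (t *: v + x)) -
    taylor k psi (phi x) (taylor_red k phi x (t *: v))).
Proof.
move=> oU oV Cphi Cpsi Ux Vy; set y := phi x.
pose u (t : R) := phi (t *: v + x) - y.
pose q (t : R) := taylor_red k phi x (t *: v).
have uq : littleo_power k (fun t => u t - q t).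
  move=> e e0; have := taylor_peano_line v oU Ux Cphi e0.
  by apply: filterS => t; rewrite taylorE opprD addrA.
have u0 : u t @[t --> (0 : R)^'+] --> 0.
  have phiu : phi (t *: v + x) @[t --> (0 : R)^'+] --> y.
    have phix : phi z @[z --> x] --> y := class_C_continuous Cphi Ux.
    exact: (cvg_comp _ _ (@ray_cvg _ _ x v) phix).
  by rewrite -(subrr y); apply: cvgB => //; exact: cvg_cst.
have [C C0 phiC] := curried_poly_lipschitz (curried_poly_taylor_red k phi x).
have [D D0 psiD] := curried_poly_lipschitz (curried_poly_taylor_red k psi y).
have qlin : \forall t \near (0 : R)^'+, `|q t| <= C * `|v| * t.
  near=> t; have t0 : 0 < t by near: t; exact: nbhs_right_gt.
  have := phiC (t *: v) 0; rewrite taylor_red0 !subr0 normr0 => qC.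
  have tv1 : `|t *: v| <= 1.
    by near: t; apply: cvgr0_norm_le ltr01; exact: ray_cvg0.
  apply: le_trans (qC tv1 ler01) _.
  by rewrite normrZ gtr0_norm// -mulrA [`|v| * t]mulrC.
(* For k = 0 the bound is trivial, whereas u t = O(t) may fail. *)
have upow : \forall t \near (0 : R)^'+, `|u t| ^+ k <= (C * `|v| + 1) ^+ k * t ^+ k.
  case: (k) uq => [|m] uq; first by near=> t; rewrite !expr0 mulr1.
  near=> t; have t0 : 0 < t by near: t; exact: nbhs_right_gt.
  have t1 : t < 1 by near: t; exact: nbhs_right_lt.
  have ut : `|u t - q t| <= 1 * t ^+ m.+1 by near: t; exact: uq.
  have qt : `|q t| <= C * `|v| * t by near: t.
  rewrite -exprMn lerXn2r ?nnegrE ?mulr_ge0 ?addr_ge0 ?mulr_ge0 ?(ltW t0)//.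
  rewrite -(subrK (q t) (u t)) addrC mulrDl.
  apply: le_trans (ler_normD _ _) _; apply: lerD => //.
  apply: le_trans ut _; rewrite ler_wpM2l// exprS ler_piMr ?(ltW t0)//.
  by rewrite exprn_ile1 ?ltW.
pose K := (C * `|v| + 1) ^+ k.
have K0 : 0 < K by rewrite exprn_gt0// ltr_wpDl ?mulr_ge0.
have outer : littleo_power k (fun t => psi (phi (t *: v + x)) - taylor k psi y (u t)).
  move=> e e0; have eK0 : 0 < e / K by rewrite divr_gt0.
  near=> t.
  have : `|psi (u t + y) - taylor k psi y (u t)| <= e / K * `|u t| ^+ k.
    by near: t; exact: u0 _ (taylor_peano oV Vy Cpsi eK0).
  rewrite /u subrK => /le_trans; apply.
  rewrite -mulrA ler_pM2l// ler_pdivrMl//.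
  by near: t.
have inner : littleo_power k (fun t => taylor k psi y (u t) - taylor k psi y (q t)).
  move=> e e0; have eD0 : 0 < e / (D + 1) by rewrite divr_gt0// ltr_wpDl.
  near=> t; rewrite !taylorE opprD addrACA subrr add0r.
  have u1 : `|u t| <= 1.
    by near: t; apply: cvgr0_norm_le ltr01; exact: u0.
  have q1 : `|q t| <= 1.
    have t0 : 0 < t by near: t; exact: nbhs_right_gt.
    have qt : `|q t| <= C * `|v| * t by near: t.
    have tC : t < 1 / (C * `|v| + 1).
      by near: t; apply: nbhs_right_lt; rewrite divr_gt0// ltr_wpDl ?mulr_ge0.
    apply: le_trans qt _.
    move: tC; rewrite ltr_pdivlMr ?ltr_wpDl ?mulr_ge0//; nra.
  have ut : `|u t - q t| <= e / (D + 1) * t ^+ k by near: t; exact: uq.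
  have t0 : 0 <= t ^+ k by rewrite exprn_ge0// ltW//; near: t; exact: nbhs_right_gt.
  apply: le_trans (psiD _ _ u1 q1) _.
  apply: (@le_trans _ _ ((D + 1) * (e / (D + 1) * t ^+ k))).
    by apply: ler_pM => //; rewrite lerDl.
  by rewrite mulrA mulrCA divff ?mulr1// gt_eqF// ltr_wpDl.
move=> e e0; have := littleo_powerD outer inner e0.
by apply: filterS => t; rewrite subrKA.
Unshelve. all: by end_near. Qed.

Theorem theorem1 (R : realType) (E F G : completeNormedModType R)
    (UE : set E) (UF : set F) (k : nat) (phi : E -> F) (psi : F -> G) (x : E)
    (UE_open : open UE) (UF_open : open UF)
    (phiC : class_C k UE phi) (psiC : class_C k UF psi)
    (UEx : UE x) (UFy : UF (phi x)) :
  [/\ open (UE `&` phi @^-1` UF),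
      class_C k (UE `&` phi @^-1` UF) (psi \o phi),
      (phi @` UE `<=` UF -> class_C k UE (psi \o phi))
    & taylor_red k (psi \o phi) x =
      trunc_deg k (taylor_red k psi (phi x) \o taylor_red k phi x)].
Proof.
have oW : open (UE `&` phi @^-1` UF).
  rewrite openE => z [Uz Vz]; apply: filterI.
    exact: open_nbhs_nbhs.
  by apply: (class_C_continuous phiC Uz); exact: open_nbhs_nbhs.
have CW : class_C k (UE `&` phi @^-1` UF) (psi \o phi).
  apply: (class_C_comp (V := UF)) oW _ _ psiC; first by move=> z [].
  by apply: class_C_sub phiC => z [].
split=> //.
  move=> phiU; apply: (class_C_comp (V := UF)) UE_open _ phiC psiC => z Uz.
  by apply: phiU; exists z.
set q := taylor_red k phi x; set p := taylor_red k psi (phi x).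
have [c pqc] := curried_poly_decomp (curried_poly_comp
  (curried_poly_taylor_red k phi x) (curried_poly_taylor_red k psi (phi x))).
apply/funext => v; rewrite /trunc_deg (hcompE pqc).
have [hc [n [cn pqE]]] := pqc.
pose a l := taylor_coef (psi \o phi) x l v - c l v.
suff a0 l : (l <= k)%N -> a l = 0.
  rewrite -[v in LHS]scale1r taylor_red_coef; apply: eq_bigr => l _.
  rewrite expr1n scale1r; apply/eqP; rewrite -subr_eq0.
  by rewrite [X in X == 0]a0// -ltnS.
apply: littleo_power_poly_eq0 => {l}.
(* The sum is extended to k.+1 + n terms so that it splits after degree k,
   whether n exceeds k or not. *)
have full t : p (q (t *: v)) = \sum_(j < k.+1 + n) t ^+ j *: c j v.
  rewrite -[p (q _)]/((p \o q) _) pqE (big_ord_widen _ (fun j => c j (t *: v))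
    (leq_addl k.+1 n)) big_mkcond.
  apply: eq_bigr => j _; rewrite -homogeneous_polyZ; last exact: hc.
  by case: ltnP => // /cn ->.
have tail := @littleo_power_tail _ _ k n (fun l => c (k.+1 + l)%N v).
have whole := taylor_peano_line v oW (conj UEx UFy) CW.
have comp := taylor_comp_line v UE_open UF_open phiC psiC UEx UFy.
move=> e e0.
have := littleo_powerD (littleo_powerD (littleo_powerN whole) comp) tail e0.
apply: filterS => t; congr (`|_| <= _).
rewrite !taylorE [taylor_red _ _ _ (taylor_red _ _ _ _)]full big_split_ord /=.
rewrite taylor_red_coef /a; under [RHS]eq_bigr do rewrite scalerBr.
rewrite sumrB.
set s1 := \sum_(l < _) _; set s2 := \sum_(l < _) _; set s3 := \sum_(l < _) _.
by rewrite opprB subrKA opprD addrACA subrr add0r opprD addrA subrK.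
Qed.
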